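(* Let $(S_m)_{m\ge0}$ and $(\tilde S_m)_{m\ge0}$ be two independent simple random walks on $\mathbb{Z}^4$, both started at the origin, and let $$X_n:=\frac1n\sum_{i=1}^n\sum_{\ell=1}^n G(S_i,\tilde S_\ell).$$ Then there exists a constant $C<\infty$ such that for all $p,n\in\mathbb{N}$, $$E[X_n^p]\le C^p\,p!.$$
   Context: Simple random walk on $\mathbb{Z}^4$: i.i.d. increments uniform on the $8$ nearest neighbours of the origin. $G(x,y):=\sum_{i=0}^\infty P^x(S_i=y)$ is the Green's function of the walk, where $P^x$ is the law of the walk started at $x$. $\mathbb{N}=\{1,2,\ldots\}$. *)

(* Defs.v *)
From HB Require Import structures.
From mathcomp Require Import all_boot all_order all_algebra.
From mathcomp Require Import all_classical all_reals all_analysis.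
From mathcomp Require Import finmap.

Set Implicit Arguments.
Unset Strict Implicit.
Unset Printing Implicit Defensive.

Import Order.TTheory GRing.Theory Num.Theory.

Local Open Scope classical_set_scope.
Local Open Scope ring_scope.

Notation Z4 := 'rV[int]_4.

Definition unit_step (v : Z4) : bool := (\sum_(j < 4) `|v 0 j| == 1)%R.

Definition increment (T : Type) (S : nat -> T -> Z4) (m : nat) (w : T) : Z4 :=
  S m.+1 w - S m w.

(* [Z4] is countable, so preimages of points determine measurability. *)
Definition discrete_process (d : measure_display) (T : measurableType d)
    (S : nat -> T -> Z4) : Prop :=
  forall m v, measurable (S m @^-1` [set v]).

Definition mutually_independent (R : realType) (d : measure_display)
    (T : measurableType d) (P : probability T R) (xi : nat -> T -> Z4) : Prop :=
  forall (J : {fset nat}) (B : nat -> set Z4),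
    P (\bigcap_(m in [set` J]) (xi m @^-1` B m)) =
    (\prod_(m <- J) P (xi m @^-1` B m))%E.

Record simple_random_walk (R : realType) (d : measure_display)
    (T : measurableType d) (P : probability T R) (x : Z4)
    (S : nat -> T -> Z4) : Prop := SimpleRandomWalk {
  srw_measurable : discrete_process S ;
  srw_start : forall w, S 0%N w = x ;
  srw_indep : mutually_independent P (increment S) ;
  srw_uniform : forall m v,
    P (increment S m @^-1` [set v]) =
    (if unit_step v then (8%:R^-1 : R)%:E else 0%E) }.

Definition process_sigma_algebra (T : Type) (S : nat -> T -> Z4) :
    set (set T) :=
  <<s [set A | exists m v, A = S m @^-1` [set v]] >>.

Definition independent_processes (R : realType) (d : measure_display)
    (T : measurableType d) (P : probability T R)
    (S S' : nat -> T -> Z4) : Prop :=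
  forall A B, process_sigma_algebra S A -> process_sigma_algebra S' B ->
    P (A `&` B) = (P A * P B)%E.

(* [S] is meant to be a walk started at the origin, so that P^x is the law of
   [x + S]; see [simple_random_walk_translate]. *)
Definition green (R : realType) (d : measure_display) (T : measurableType d)
    (P : probability T R) (S : nat -> T -> Z4) (x y : Z4) : \bar R :=
  (\sum_(0 <= i <oo) P [set w | (x + S i w)%R = y])%E.

Lemma simple_random_walk_translate (R : realType) (d : measure_display)
    (T : measurableType d) (P : probability T R) (S : nat -> T -> Z4) (x : Z4) :
  simple_random_walk P 0 S -> simple_random_walk P x (fun m w => x + S m w).
Proof.
case=> mS S0 iS uS.
have incE : increment (fun m w => x + S m w) = increment S.
  by apply/funext => m; apply/funext => w; rewrite /increment opprD addrACA subrr add0r.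
split; rewrite ?incE //.
- move=> m v; rewrite (_ : _ @^-1` _ = S m @^-1` [set v - x]); first exact: mS.
  apply/seteqP; split => w /=; first by move=> <-; rewrite addrAC subrr add0r.
  by move=> ->; rewrite addrC subrK.
- by move=> w; rewrite S0 addr0.
Qed.

Definition green_average (R : realType) (d : measure_display)
    (T : measurableType d) (P : probability T R) (S S' : nat -> T -> Z4)
    (n : nat) (w : T) : \bar R :=
  ((n%:R^-1 : R)%:E *
   \sum_(1 <= i < n.+1) \sum_(1 <= l < n.+1) green P S (S i w) (S' l w))%E.

(* Main.v *)
Require Import Defs.
From mathcomp Require Import all_boot all_order all_algebra.
From mathcomp Require Import all_classical all_reals all_analysis.
From mathcomp Require Import measurable_realfun finmap ring lra zify.

(* Let p_j be the heat kernel.  Splitting the coordinates into two planes and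
   rotating each by 45 degrees writes p_j as a binomial mixture of products of
   four one-dimensional kernels, whence p_j <= 16/((j+1)(j+2)).  The tail
   beyond 2n of the Green function therefore contributes O(1) to X_n, and the
   truncated Green function is dominated near the origin by a kernel of the form
   K(x,y) = sum_i phi_i(x) phi_i(y), with finitely many phi_i >= 0, such that
   E K(x + S_a, y + S'_b) <= kappa/(a+b+1).

   Expanding the p-th power and using independence,
     E (sum_{i,l} K(S_i,S'_l))^p = sum_{i_1..i_p} (E prod_j L_{i_j})^2,
   where L_i is the total of phi_i along the walk.  Bounding the product by a
   sum over the factor visited first and applying the Cauchy-Schwarz inequality
   over (i_1..i_p) replaces the double sum over the orders in which the two
   walks visit by (p!)^2 times the diagonal term, in which both walks visit the
   factors in the same order.  Summing out the visiting times against t^(a+b)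
   with sum_{a,b} t^(a+b)/(a+b+1) = 1/(1-t) gives
     (p!)^2 (kappa/(1-t))^p t^(-2n).
   For p <= n take t = n/(n+p); for p > n use X_n <= 16 n and p^p <= e^p p!. *)

Set Implicit Arguments.
Unset Strict Implicit.
Unset Printing Implicit Defensive.

Import Order.TTheory GRing.Theory Num.Theory.

Local Open Scope classical_set_scope.
Local Open Scope ring_scope.

(** * Averages over nearest neighbours *)

Definition steps : seq Z4 :=
  [seq delta_mx 0 k | k : 'I_4 <- enum 'I_4] ++ [seq - delta_mx 0 k | k : 'I_4 <- enum 'I_4].

Lemma size_steps : size steps = 8%N.
Proof.
by rewrite size_cat size_map size_enum_ord size_map size_enum_ord. Qed.

Lemma steps_unit e : e \in steps -> unit_step e.
Proof.
have unit_delta (k : 'I_4) : unit_step (delta_mx 0 k).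
  rewrite /unit_step (bigD1 k) //= big1 ?addr0 ?mxE ?eqxx ?normr1 //.
  by move=> j jk; rewrite mxE (negbTE jk) andbF normr0.
rewrite mem_cat => /orP[] /mapP[k _ ->]; first exact: unit_delta.
rewrite /unit_step; under eq_bigr do rewrite mxE normrN; exact: unit_delta.
Qed.

Lemma uniq_steps : uniq steps.
Proof.
have delta_inj : injective (fun k : 'I_4 => delta_mx 0 k : Z4).
  move=> k k' /rowP/(_ k); rewrite !mxE !eqxx /=.
  by case: (k =P k').
have oppr_delta_inj : injective (fun k : 'I_4 => - delta_mx 0 k : Z4).
  by move=> k k' /oppr_inj; apply: delta_inj.
rewrite cat_uniq (map_inj_uniq delta_inj) (map_inj_uniq oppr_delta_inj).
rewrite enum_uniq /= andbT; apply/hasPn => _ /mapP[k _ ->].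
apply/negP => /mapP[k' _] /rowP/(_ k); rewrite !mxE !eqxx /=.
by case: (k == k').
Qed.

Section Average.
Variable R : realType.
Implicit Types (f g : Z4 -> R) (x y z : Z4).

Lemma big_steps (F : Z4 -> R) :
  \sum_(e <- steps) F e = \sum_(k < 4) (F (delta_mx 0 k) + F (- delta_mx 0 k)).
Proof. by rewrite big_split big_cat; congr (_ + _); rewrite big_map big_enum. Qed.

Lemma big_stepsN (F : Z4 -> R) :
  \sum_(e <- steps) F (- e) = \sum_(e <- steps) F e.
Proof.
by rewrite !big_steps; apply: eq_bigr => k _; rewrite opprK addrC.
Qed.

Definition avg f x : R := 8%:R^-1 * \sum_(e <- steps) f (x + e).

Lemma eq_avg f g : f =1 g -> avg f =1 avg g.
Proof. by move=> fg x; congr (_ * _); apply: eq_bigr. Qed.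

Lemma avg_cst (c : R) x : avg (fun=> c) x = c.
Proof.
by rewrite /avg big_const_seq count_predT size_steps iter_addr_0; field.
Qed.

Lemma le_avg f g : (forall x, f x <= g x) -> forall x, avg f x <= avg g x.
Proof.
by move=> fg x; apply: ler_wpM2l; rewrite ?invr_ge0 //; apply: ler_sum.
Qed.

Lemma avgZ c f x : avg (fun y => c * f y) x = c * avg f x.
Proof. by rewrite /avg -mulr_sumr mulrCA. Qed.

Lemma avg_sum (I : Type) (r : seq I) (F : I -> Z4 -> R) x :
  avg (fun y => \sum_(i <- r) F i y) x = \sum_(i <- r) avg (F i) x.
Proof. by rewrite /avg exchange_big /= mulr_sumr. Qed.

Lemma avg_translate f z x : avg (fun y => f (y + z)) x = avg f (x + z).
Proof. by congr (_ * _); apply: eq_bigr => e _; rewrite addrAC. Qed.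

Lemma avgN f x : avg (fun y => f (- y)) x = avg f (- x).
Proof.
congr (_ * _); rewrite -big_stepsN; apply: eq_bigr => e _.
by rewrite opprD opprK.
Qed.

Definition avgn j f := iter j avg f.

Lemma avgnS j f x : avgn j.+1 f x = avg (avgn j f) x. Proof. by []. Qed.

Lemma avgnD i j f : avgn (i + j) f = avgn i (avgn j f).
Proof. exact: iterD. Qed.

Lemma eq_avgn j f g : f =1 g -> avgn j f =1 avgn j g.
Proof. by move=> fg; elim: j => //= j IHj x; apply: eq_avg. Qed.

Lemma le_avgn j f g : (forall x, f x <= g x) -> forall x, avgn j f x <= avgn j g x.
Proof. by move=> fg; elim: j => //= j IHj x; apply: le_avg. Qed.

Lemma avgn_cst j (c : R) x : avgn j (fun=> c) x = c.
Proof. by elim: j x => //= j IHj x; rewrite (eq_avg IHj) avg_cst. Qed.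

Lemma avgn_ge0 j f : (forall x, 0 <= f x) -> forall x, 0 <= avgn j f x.
Proof. by move=> f0 x; rewrite -(avgn_cst j 0 x); apply: le_avgn. Qed.

Lemma avgnZ j c f x : avgn j (fun y => c * f y) x = c * avgn j f x.
Proof. by elim: j x => //= j IHj x; rewrite (eq_avg IHj) avgZ. Qed.

Lemma avgn_sum (I : Type) (r : seq I) j (F : I -> Z4 -> R) x :
  avgn j (fun y => \sum_(i <- r) F i y) x = \sum_(i <- r) avgn j (F i) x.
Proof. by elim: j x => //= j IHj x; rewrite (eq_avg IHj) avg_sum. Qed.

Lemma avgnDf j f g x : avgn j (fun y => f y + g y) x = avgn j f x + avgn j g x.
Proof.
have := avgn_sum [:: true; false] j (fun b => if b then f else g) x.
by rewrite !big_cons big_nil addr0 => <-; apply: eq_avgn => y; rewrite !big_cons big_nil addr0.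
Qed.

Lemma avgn_translate j f z x : avgn j (fun y => f (y + z)) x = avgn j f (x + z).
Proof. by elim: j x => //= j IHj x; rewrite (eq_avg IHj) avg_translate. Qed.

Lemma avgnN j f x : avgn j (fun y => f (- y)) x = avgn j f (- x).
Proof. by elim: j x => //= j IHj x; rewrite (eq_avg IHj) avgN. Qed.

(** The probability that [j] steps from [x] end at the origin, built from the averaging operator
    alone. The measure [P] is compared with it only in [prob_walk_le]. *)
Definition hk j : Z4 -> R := avgn j (fun x => (x == 0)%:R).

Lemma hk_ge0 j x : 0 <= hk j x.
Proof. by apply: avgn_ge0 => y; rewrite ler0n. Qed.

Lemma hkN j x : hk j (- x) = hk j x.
Proof. by rewrite /hk -avgnN; apply: eq_avgn => y; rewrite oppr_eq0. Qed.

Lemma avgn_hk i j z x : avgn i (fun y => hk j (y - z)) x = hk (i + j) (x - z).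
Proof. by rewrite (avgn_translate i (hk j) (- z)) /hk avgnD. Qed.

Lemma hkE j z x : hk j (x - z) = avgn j (fun y => (y == z)%:R) x.
Proof.
rewrite /hk -(avgn_translate j _ (- z)).
by apply: eq_avgn => y; rewrite subr_eq0.
Qed.

(** Chapman-Kolmogorov with midpoints restricted to [Z]. Writing the first kernel as an average of
    indicators turns the sum into the average of a function equal to [hk j (w - y)] for [w] in [Z]
    and to zero elsewhere. *)
Lemma sum_hk_le (Z : seq Z4) i j x y : uniq Z ->
  \sum_(z <- Z) hk i (x - z) * hk j (y - z) <= hk (i + j) (x - y).
Proof.
move=> uZ; rewrite -avgn_hk.
under eq_bigr => z _ do rewrite hkE mulrC -avgnZ.
rewrite -avgn_sum; apply: le_avgn => w.
have [wZ|wZ] := boolP (w \in Z).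
  rewrite (bigD1_seq w) //= eqxx mulr1 big1 ?addr0; first by rewrite -hkN opprB.
  by move=> z /negbTE zw; rewrite eq_sym zw mulr0.
rewrite big_seq big1 ?hk_ge0 // => z zZ.
by case: eqP => [wz|]; rewrite ?mulr0 //; rewrite wz zZ in wZ.
Qed.

(** The sites at most [r] steps away from the origin, listed without repetition so that sums over
    midpoints are finite. *)
Fixpoint reach (r : nat) : seq Z4 :=
  if r is r'.+1 then undup (reach r' ++ [seq x + e | x <- reach r', e <- steps])
  else [:: 0].

Lemma uniq_reach r : uniq (reach r).
Proof. by case: r => //= r; apply: undup_uniq. Qed.

Lemma reach_step r x e : x \in reach r -> e \in steps -> x + e \in reach r.+1.
Proof.
move=> xr es; rewrite /= mem_undup mem_cat; apply/orP; right.
exact: allpairs_f.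
Qed.

Lemma subset_reach r r' x : (r <= r')%N -> x \in reach r -> x \in reach r'.
Proof.
move=> /subnK <-; elim: (_ - _)%N => //= k IHk xr.
by rewrite /= mem_undup mem_cat IHk.
Qed.

Lemma avgn_local j r f g x :
    (forall y, y \in reach (r + j) -> f y = g y) -> x \in reach r ->
  avgn j f x = avgn j g x.
Proof.
elim: j r x => [|j IHj] r x fg xr; first by apply: fg; rewrite addn0.
rewrite !avgnS; congr (_ * _); apply: eq_big_seq => e es.
by apply: (IHj r.+1); [rewrite addSnnS | apply: reach_step].
Qed.

(** In [i] steps a walk from [x] cannot leave [reach (r + i)], so no midpoint is lost and
    Chapman-Kolmogorov is exact. *)
Lemma sum_hk_reach r i j x y : x \in reach r ->
  \sum_(z <- reach (r + i)) hk i (x - z) * hk j (y - z) = hk (i + j) (x - y).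
Proof.
move=> xr; rewrite -avgn_hk.
under eq_bigr => z _ do rewrite hkE mulrC -avgnZ.
rewrite -avgn_sum; apply: (avgn_local _ xr) => w wZ.
rewrite (bigD1_seq w) ?uniq_reach //= eqxx mulr1 big1 ?addr0; first by rewrite -hkN opprB.
by move=> z /negbTE zw; rewrite eq_sym zw mulr0.
Qed.

End Average.

Arguments hk : simpl never.

(** * Heat kernel decay *)

Lemma leq_bin_half k i : ('C(k, i) <= 'C(k, k./2))%N.
Proof.
(* Binomials increase up to the middle; the induction is on the distance [d] to it. The upper half
   follows by symmetry. *)
have half_le j d : (j + d = k./2)%N -> ('C(k, j) <= 'C(k, k./2))%N.
  elim: d j => [|d IHd] j; first by rewrite addn0 => ->.
  rewrite addnS -addSn => jd; apply: leq_trans (IHd _ jd).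
  rewrite -(@leq_pmul2l j.+1) // mul_bin_left leq_mul2r; apply/orP; right; lia.
have [ik|ki] := leqP i k./2; first by apply: (@half_le i (k./2 - i)%N); lia.
have [ik|/bin_small ->//] := leqP i k.
by rewrite -bin_sub //; apply: (@half_le _ (k./2 - (k - i))%N); lia.
Qed.

Lemma mul_central_bin m :
  (m.+1 * 'C(m.+1.*2, m.+1) = 2 * m.*2.+1 * 'C(m.*2, m))%N.
Proof.
have := mul_bin_diag m.*2.+2 m; have := mul_bin_down m.*2.+1 m.
rewrite doubleS /=; nia.
Qed.

(** Passing from m to m+1 multiplies the left side by 4(2m+1)(2m+3)/(m+1)^2, which is at most 16. *)
Lemma central_bin_sqr_le m : ('C(m.*2, m) ^ 2 * m.*2.+1 <= 16 ^ m)%N.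
Proof.
elim: m => [//|m IHm]; rewrite -(@leq_pmul2l (m.+1 ^ 2)) ?expn_gt0 //.
rewrite mulnA -expnMn mul_central_bin.
rewrite [leqLHS](_ : _ = 4 * ('C(m.*2, m) ^ 2 * m.*2.+1) *
  (m.*2.+1 * m.*2.+3))%N; last by rewrite doubleS; ring.
rewrite [leqRHS](_ : _ = 4 * 16 ^ m * (4 * m.+1 ^ 2))%N; last by rewrite (expnS 16); ring.
by apply: leq_mul; [rewrite leq_mul2l IHm | rewrite -!muln2 -!mulnn; lia].
Qed.

Lemma bin_sqr_le k i : ('C(k, i) ^ 2 * k.+1 <= 2 * 4 ^ k)%N.
Proof.
apply: leq_trans (_ : 'C(k, k./2) ^ 2 * k.+1 <= _)%N.
  by rewrite leq_mul2r leq_sqr leq_bin_half orbT.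
have [m km] : exists m, k = m.*2 \/ k = m.*2.+1.
  by exists k./2; have := odd_double_half k; case: odd => /= ?; [right|left]; lia.
case: km => ->; rewrite /= ?uphalf_double ?doubleK.
  apply: leq_trans (central_bin_sqr_le m) _.
  by rewrite (_ : 16 = 4 ^ 2)%N // -expnM mul2n leq_pmull.
(* For odd [k] the middle coefficient is half of the next central one, so the even bound at [m.+1]
   applies. *)
have e : ('C(m.+1.*2, m.+1) = 2 * 'C(m.*2.+1, m))%N.
  by have := mul_bin_diag m.*2.+2 m; rewrite doubleS /=; nia.
have := central_bin_sqr_le m.+1; rewrite e expnMn doubleS.
by rewrite (expnS 16) (expnS 4) (_ : 4 ^ m.*2 = 16 ^ m)%N -1?mul2n ?expnM //; nia.
Qed.

Section HeatKernel.
Variable R : realType.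

(* [C(k, w / 2)], the number of [k]-step [+1/-1] paths ending at [w - k]. *)
Definition binz (k : nat) (w : int) : nat :=
  if w is Posz w' then (if odd w' then 0 else 'C(k, w'./2))%N else 0%N.

Lemma binzS k w : binz k.+1 w = (binz k w + binz k (w - 2))%N.
Proof.
case: w => [[|[|w]]|w]; [by rewrite /= !bin0 | by [] | |].
  rewrite (_ : w.+2%:Z - 2 = w) /=; last by lia.
  by rewrite negbK; case: odd => //=; rewrite binS addnC.
by rewrite (_ : Negz w - 2 = Negz w.+2) //; lia.
Qed.

Definition srw1 (k : nat) (z : int) : R := (binz k (z + k%:Z))%:R / 2 ^+ k.

Lemma srw1_ge0 k z : 0 <= srw1 k z.
Proof. by rewrite divr_ge0 ?exprn_ge0. Qed.

Lemma srw10 z : srw1 0 z = (z == 0)%:R.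
Proof.
rewrite /srw1 addr0 expr0 divr1; case: z => [[|[|z]]|z] //=.
by rewrite negbK; case: odd.
Qed.

Lemma srw1S k z : srw1 k.+1 z = (srw1 k (z - 1) + srw1 k (z + 1)) / 2.
Proof.
rewrite /srw1 (_ : z + k.+1%:Z = z + 1 + k%:Z); last by lia.
rewrite binzS (_ : z + 1 + k%:Z - 2 = z - 1 + k%:Z); last by lia.
by rewrite exprS natrD; field; rewrite expf_neq0.
Qed.

Lemma srw1_sqr_le k z : srw1 k z ^+ 2 <= 2 / k.+1%:R.
Proof.
have le_sqr : (binz k (z + k%:Z) ^ 2 * k.+1 <= 2 * 4 ^ k)%N.
  by rewrite /binz; case: (z + _) => // w; case: odd => //; apply: bin_sqr_le.
rewrite /srw1 expr_div_n -exprM mulnC exprM -!natrX ler_pdivrMr ?ltr0n ?expn_gt0 //.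
rewrite mulrAC ler_pdivlMr ?ltr0n // -!natrM ler_nat.
by rewrite (_ : 2 ^ 2 = 4)%N.
Qed.

Lemma srw1_mul_le k z z' : srw1 k z * srw1 k z' <= 2 / k.+1%:R.
Proof.
have := srw1_sqr_le k z; have := srw1_sqr_le k z'.
have := sqr_ge0 (srw1 k z - srw1 k z').
move: (srw1 k z) (srw1 k z') (2 / _) => a b c; rewrite !expr2; nra.
Qed.

(* Rotating the lattice by 45 degrees turns planar simple random walk into a
   pair of independent one-dimensional walks. *)
Definition srw2 (k : nat) (x y : int) : R := srw1 k (x + y) * srw1 k (x - y).

Lemma srw2_ge0 k x y : 0 <= srw2 k x y.
Proof. by rewrite mulr_ge0 ?srw1_ge0. Qed.

Lemma srw20 x y : srw2 0 x y = ((x == 0) && (y == 0))%:R.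
Proof.
rewrite /srw2 !srw10 -natrM mulnb; congr (_%:R); congr nat_of_bool.
by apply/andP/andP => -[/eqP ? /eqP ?]; split; apply/eqP; lia.
Qed.

Lemma srw2S k x y : srw2 k.+1 x y =
  (srw2 k (x + 1) y + srw2 k (x - 1) y + srw2 k x (y + 1) + srw2 k x (y - 1)) / 4.
Proof.
rewrite /srw2 !srw1S.
rewrite (_ : x + 1 + y = x + y + 1); last by ring.
rewrite (_ : x - 1 + y = x + y - 1); last by ring.
rewrite (_ : x + 1 - y = x - y + 1); last by ring.
rewrite (_ : x - 1 - y = x - y - 1); last by ring.
rewrite (_ : x + (y + 1) = x + y + 1); last by ring.
rewrite (_ : x + (y - 1) = x + y - 1); last by ring.
rewrite (_ : x - (y + 1) = x - y - 1); last by ring.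
rewrite (_ : x - (y - 1) = x - y + 1); last by ring.
by field.
Qed.

Lemma srw2_le k x y : srw2 k x y <= 2 / k.+1%:R.
Proof. exact: srw1_mul_le. Qed.

(** Pascal's rule: the additional step is given either to [u] or to [w]. It drives the induction in
    [hk_formula]. *)
Lemma binomial_convS (u w : nat -> R) j :
  \sum_(k < j.+2) 'C(j.+1, k)%:R * (u k * w (j.+1 - k)%N) =
  \sum_(k < j.+1) 'C(j, k)%:R * (u k.+1 * w (j - k)%N + u k * w (j - k).+1).
Proof.
rewrite big_ord_recl /= bin0 subn0.
under eq_bigr => k _ do rewrite /bump /= add1n binS natrD mulrDl subSS.
rewrite big_split /= addrA; under [RHS]eq_bigr => k _ do rewrite mulrDr.
rewrite big_split /= addrC; congr (_ + _).
rewrite big_ord_recr /= bin_small // mul0r addr0.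
rewrite [RHS]big_ord_recl /= bin0 subn0; congr (_ + _).
by apply: eq_bigr => k _; rewrite /bump /= add1n subnSK.
Qed.

(* [k] steps are taken in the first coordinate plane and [j - k] in the second. *)
Lemma hk_formula j (x : Z4) : hk R j x = 2^-1 ^+ j * \sum_(k < j.+1)
  'C(j, k)%:R * (srw2 k (x 0 0) (x 0 1) * srw2 (j - k) (x 0 2) (x 0 3)).
Proof.
elim: j x => [|j IHj] x.
  rewrite big_ord1 expr0 bin0 !mul1r !srw20 -natrM mulnb /hk /=.
  congr (_%:R); congr nat_of_bool; apply/eqP/idP => [->|]; first by rewrite !mxE !eqxx.
  move=> /andP[/andP[/eqP x0 /eqP x1] /andP[/eqP x2 /eqP x3]].
  apply/rowP => i; rewrite mxE; case: i => [[|[|[|[|//]]]] lti].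
  - by rewrite -[RHS]x0; congr (x _ _); apply: val_inj.
  - by rewrite -[RHS]x1; congr (x _ _); apply: val_inj.
  - by rewrite -[RHS]x2; congr (x _ _); apply: val_inj.
  - by rewrite -[RHS]x3; congr (x _ _); apply: val_inj.
rewrite (binomial_convS (fun k => srw2 k _ _) (fun k => srw2 k _ _)) /hk avgnS.
rewrite (eq_avg IHj) avgZ avg_sum exprS -mulrA mulrCA.
congr (_ * _); rewrite mulr_sumr; apply: eq_bigr => k _.
rewrite avgZ [RHS]mulrCA; congr (_ * _).
(* Four of the eight neighbours move the first plane and four the second; each group averages to one
   planar step. *)
rewrite /avg big_steps !big_ord_recl big_ord0 !mxE /= !addr0.
by rewrite !srw2S; field.
Qed.

(** Both denominators are absorbed by raising the indices of the binomial, leaving entries of row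
    [j.+2] of Pascal's triangle. *)
Lemma bin_div_le j k : (k <= j)%N ->
  'C(j, k)%:R / (k.+1%:R * (j - k).+1%:R) =
  'C(j.+2, k.+1)%:R / (j.+1%:R * j.+2%:R) :> R.
Proof.
move=> kj; apply/eqP; rewrite eqr_div ?mulf_neq0 ?pnatr_eq0 // -!natrM eqr_nat.
have := mul_bin_diag j.+1 k; have := mul_bin_down j.+2 k.+1.
rewrite /= subSS -subSn //; nia.
Qed.

(** The two planar kernels contribute 2/(k+1) and 2/(j-k+1). After absorption the binomials sum to
    at most 2^(j+2), and 4 * 2^(j+2) / 2^j = 16. *)
Lemma hk_le j x : hk R j x <= 16 / (j.+1%:R * j.+2%:R).
Proof.
rewrite hk_formula.
apply: (@le_trans _ _ (2^-1 ^+ j * \sum_(k < j.+1)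
    4 * ('C(j.+2, k.+1)%:R / (j.+1%:R * j.+2%:R)))).
  rewrite ler_wpM2l ?exprn_ge0 ?invr_ge0 //; apply: ler_sum => k _.
  rewrite -bin_div_le -1?ltnS // [leRHS](_ : _ = 'C(j, k)%:R *
    (2 / k.+1%:R * (2 / (j - k).+1%:R))); last first.
    by field; rewrite !nat1r !pnatr_eq0.
  by apply: ler_wpM2l => //; apply: ler_pM; rewrite ?srw2_ge0 ?srw2_le.
rewrite -mulr_sumr -mulr_suml -natr_sum exprVn.
have le_pow : (\sum_(k < j.+1) 'C(j.+2, k.+1) <= 2 ^ j.+2)%N.
  rewrite -[2%N]/(1 + 1)%N expnDn [leqRHS]big_ord_recl [in leqRHS]big_ord_recr /=.
  rewrite addnCA; apply: leq_trans (leq_addr _ _).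
  by apply: leq_sum => k _; rewrite !exp1n !muln1.
rewrite [leRHS](_ : _ = 2 ^- j * (4 * ((2 ^ j.+2)%:R / (j.+1%:R * j.+2%:R)))); last first.
  rewrite natrX !exprS; field.
  by rewrite -natrD nat1r expf_neq0 ?pnatr_eq0.
apply: ler_wpM2l; first by rewrite invr_ge0 exprn_ge0.
by apply: ler_wpM2l => //; apply: ler_wpM2r; rewrite ?ler_nat // invr_ge0 mulr_ge0.
Qed.

End HeatKernel.

(** * Moments of products of occupation sums *)

Section Expectation.
Variable R : realType.
Implicit Types (F G : seq Z4 -> R) (x y : Z4).

(** A term of the expanded product either contains no [a], or contains some [a k] and is then
    counted in the [k]-th summand. Terms with several [a] are counted repeatedly, whence the
    inequality. *)
Lemma prodD_le (I : eqType) (r : seq I) (a b : I -> R) : uniq r ->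
    (forall i, 0 <= a i) -> (forall i, 0 <= b i) ->
  \prod_(j <- r) (a j + b j) <= \prod_(j <- r) b j +
    \sum_(k <- r) a k * \prod_(j <- r | j != k) (a j + b j).
Proof.
move=> + a0 b0; have ab0 i : 0 <= a i + b i by rewrite addr_ge0.
elim: r => [|i r IHr] /=; first by rewrite !big_nil addr0.
move=> /andP[ir ur]; rewrite !big_cons eqxx /= mulrDl.
have prod_r : \prod_(j <- r | j != i) (a j + b j) = \prod_(j <- r) (a j + b j).
  rewrite big_seq_cond [RHS]big_seq; apply: eq_bigl => j.
  by case jr : (j \in r) => //=; apply: contraNneq ir => <-.
rewrite prod_r addrCA lerD2l.
apply: le_trans (ler_wpM2l (b0 i) (IHr ur)) _; rewrite mulrDr lerD2l.
rewrite mulr_sumr [leLHS]big_seq [leRHS]big_seq; apply: ler_sum => k kr.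
rewrite big_cons ifT; last by apply: contraNneq ir => ->.
rewrite mulrCA ler_wpM2l // ler_wpM2r ?prodr_ge0 //.
by rewrite lerDr.
Qed.

(* [expect n x F] is the mean of [F [:: S_1; ...; S_n]] for the walk started at [x]. *)
Fixpoint expect n x F : R :=
  if n is n'.+1 then avg (fun y => expect n' y (fun s => F (y :: s))) x else F [::].

Lemma eq_expect n x F G : F =1 G -> expect n x F = expect n x G.
Proof.
elim: n x F G => [|n IHn] x F G FG /=; first exact: FG.
by apply: eq_avg => y; apply: IHn.
Qed.

Lemma le_expect n x F G : (forall s, F s <= G s) -> expect n x F <= expect n x G.
Proof.
elim: n x F G => [|n IHn] x F G FG /=; first exact: FG.
by apply: le_avg => y; apply: IHn.
Qed.

Lemma expect_cst n x (c : R) : expect n x (fun=> c) = c.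
Proof.
elim: n x => [//|n IHn] x /=.
by rewrite (eq_avg (g := fun=> c)) ?avg_cst // => y; apply: IHn.
Qed.

Lemma expect_ge0 n x F : (forall s, 0 <= F s) -> 0 <= expect n x F.
Proof. by move=> F0; rewrite -(expect_cst n x 0); apply: le_expect. Qed.

Lemma expectZ n x c F : expect n x (fun s => c * F s) = c * expect n x F.
Proof.
elim: n x F => [//|n IHn] x F /=.
by rewrite -avgZ; apply: eq_avg => y; apply: IHn.
Qed.

Lemma expect_sum (I : Type) (r : seq I) n x (F : I -> seq Z4 -> R) :
  expect n x (fun s => \sum_(i <- r) F i s) = \sum_(i <- r) expect n x (F i).
Proof.
elim: n x F => [//|n IHn] x F /=.
by rewrite -avg_sum; apply: eq_avg => y; apply: IHn.
Qed.

Lemma expectD n x F G :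
  expect n x (fun s => F s + G s) = expect n x F + expect n x G.
Proof.
have := expect_sum [:: true; false] n x (fun b => if b then F else G).
rewrite !big_cons big_nil addr0 => <-.
by apply: eq_expect => s; rewrite !big_cons big_nil addr0.
Qed.

End Expectation.

(** * Inequalities for sums of products in two variables *)

Section TwoVariables.
Variable R : realType.

Lemma sum_avgnM (I : finType) (F G : I -> Z4 -> R) a b x y :
  \sum_i avgn a (F i) x * avgn b (G i) y =
  avgn a (fun x' => avgn b (fun y' => \sum_i F i x' * G i y') y) x.
Proof.
rewrite (eq_avgn a (g := fun x' => \sum_i avgn b (G i) y * F i x')).
  by rewrite avgn_sum; apply: eq_bigr => i _; rewrite avgnZ mulrC.
move=> x'; rewrite avgn_sum; apply: eq_bigr => i _.
by rewrite avgnZ mulrC.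
Qed.

(** Averaging in each variable is linear and monotone, so a pointwise comparison of kernels survives
    it. *)
Lemma le_sum_avgnM (I J : finType) (F G : I -> Z4 -> R) (F' G' : J -> Z4 -> R) c a b x y :
    (forall x' y', \sum_i F i x' * G i y' <= c * \sum_j F' j x' * G' j y') ->
  \sum_i avgn a (F i) x * avgn b (G i) y <=
  c * \sum_j avgn a (F' j) x * avgn b (G' j) y.
Proof.
move=> FG; rewrite !sum_avgnM -avgnZ; apply: le_avgn => x'.
by rewrite -avgnZ; apply: le_avgn => y'; apply: FG.
Qed.

(** At most m+1 pairs have a+b = m, which cancels the denominator and leaves a geometric series. *)
Lemma sum_pow_div_le (t : R) N : 0 < t < 1 ->
  \sum_(a < N) \sum_(b < N) t ^+ (a + b) / (a + b).+1%:R <= (1 - t)^-1.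
Proof.
move=> /andP[t0 t1]; have t1' : 0 < 1 - t by rewrite subr_gt0.
(* For fixed [a] the sum is reindexed by m = a+b and extended to a range independent of [a], so that
   the two sums can be exchanged. *)
have inner (a : 'I_N) : \sum_(b < N) t ^+ (a + b) / (a + b).+1%:R <=
    \sum_(m < N + N) if (a <= m)%N then t ^+ m / m.+1%:R else 0.
  have aN := ltn_ord a.
  rewrite -(big_mkord xpredT (fun b => t ^+ (a + b) / (a + b).+1%:R)).
  rewrite -(big_mkord xpredT (fun m => if (a <= m)%N then t ^+ m / m.+1%:R else 0)).
  rewrite [leRHS](big_cat_nat (n := a)) //=; last by lia.
  rewrite [X in _ <= _ + X](big_cat_nat (n := (a + N)%N)) /=; [|lia|lia].
  have term_ge0 m : 0 <= if (a <= m)%N then t ^+ m / m.+1%:R else 0.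
    by case: ifP => // _; rewrite divr_ge0 ?exprn_ge0 ?ltW.
  rewrite ler_wpDl ?sumr_ge0 // ler_wpDr ?sumr_ge0 //.
  rewrite -[X in _ <= \sum_(X <= _ < _) _]add0n big_addn addKn.
  by apply: ler_sum => i _; rewrite leq_addl addnC.
apply: le_trans (ler_sum _ (fun a _ => inner a)) _.
rewrite exchange_big /=.
apply: (@le_trans _ _ (\sum_(m < N + N) t ^+ m)).
  apply: ler_sum => m _; rewrite -big_mkcond /= sumr_const.
  rewrite -[_ *+ #|_|]mulr_natr mulrAC ler_pdivrMr ?ltr0n //.
  apply: ler_wpM2l; [exact: exprn_ge0 (ltW t0) | rewrite ler_nat].
  rewrite cardE -(size_map val) -[leqRHS](size_iota 0).
  apply: uniq_leq_size => [|_ /mapP[a + ->]].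
    by rewrite map_inj_uniq ?enum_uniq //; apply: val_inj.
  by rewrite mem_enum mem_iota add0n ltnS.
have -> : \sum_(m < N + N) t ^+ m = (1 - t ^+ (N + N)) / (1 - t).
  by rewrite -[1 - t ^+ _]opprB subrX1 -mulNr opprB mulrAC divff ?mul1r ?gt_eqF.
by rewrite ler_pdivrMr // mulVf ?gt_eqF // gerBl exprn_ge0 // ltW.
Qed.

(** Cauchy-Schwarz without square roots: 2(wf)(ug) is at most (wf)^2 + (ug)^2, summed over the
    index. *)
Lemma sum_mul_le (I : finType) (f g : I -> R) (B u w : R) : 0 < u -> 0 < w ->
    \sum_i f i ^+ 2 <= B * u ^+ 2 -> \sum_i g i ^+ 2 <= B * w ^+ 2 ->
  \sum_i f i * g i <= B * (u * w).
Proof.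
move=> u0 w0 fB gB; have uw0 : 0 < u * w by rewrite mulr_gt0.
rewrite -(@ler_pM2l _ (2 * (u * w))) ?mulr_gt0 //.
apply: (@le_trans _ _ (\sum_i (w ^+ 2 * f i ^+ 2 + u ^+ 2 * g i ^+ 2))).
  rewrite mulr_sumr; apply: ler_sum => i _.
  have := sqr_ge0 (w * f i - u * g i); rewrite sqrrB !exprMn; lra.
rewrite big_split /= -!mulr_sumr.
apply: (@le_trans _ _ (w ^+ 2 * (B * u ^+ 2) + u ^+ 2 * (B * w ^+ 2))).
  by apply: lerD; apply: ler_wpM2l; rewrite ?sqr_ge0.
by rewrite le_eqVlt; apply/orP; left; apply/eqP; ring.
Qed.

End TwoVariables.

Definition ffun_del (A : Type) p (k : 'I_p.+1) (l : {ffun 'I_p.+1 -> A}) :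
  {ffun 'I_p -> A} := [ffun j => l (lift k j)].

Lemma sum_ffun_del (R : realType) (A : finType) p (k : 'I_p.+1)
    (F : A -> {ffun 'I_p -> A} -> R) :
  \sum_(l : {ffun 'I_p.+1 -> A}) F (l k) (ffun_del k l) = \sum_(c : A * {ffun 'I_p -> A}) F c.1 c.2.
Proof.
pose ins (c : A * {ffun 'I_p -> A}) : {ffun 'I_p.+1 -> A} :=
  [ffun j => if unlift k j is Some j' then c.2 j' else c.1].
have insk c : ins c k = c.1 by rewrite ffunE unlift_none.
have del_ins c : ffun_del k (ins c) = c.2.
  by apply/ffunP => j; rewrite !ffunE liftK.
rewrite (reindex ins); first by apply: eq_bigr => c _; rewrite insk del_ins.
exists (fun l : {ffun 'I_p.+1 -> A} => (l k, ffun_del k l)) => [[a l] _|l _].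
  by rewrite insk del_ins.
by apply/ffunP => j; rewrite ffunE; case: unliftP => [j' ->|->]; rewrite ?ffunE.
Qed.

(** * Moments by decomposition at the first visit *)

Section OccupationMoments.
Variables (R : realType) (A : finType) (phi : A -> Z4 -> R) (kappa : R).
Hypothesis kappa_ge0 : 0 <= kappa.
Hypothesis phi_ge0 : forall i x, 0 <= phi i x.
Hypothesis decay : forall a b x y,
  \sum_i avgn a (phi i) x * avgn b (phi i) y <= kappa / (a + b).+1%:R.
Implicit Types (s : seq Z4) (x y : Z4).

Definition occupation (i : A) s : R := \sum_(x <- s) phi i x.

Lemma occupation_ge0 i s : 0 <= occupation i s.
Proof. by apply: sumr_ge0 => x _. Qed.

(* The starting point counts as a visited site. *)
Definition moment n p (l : {ffun 'I_p -> A}) x : R :=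
  expect n x (fun s => \prod_j occupation (l j) (x :: s)).

Lemma moment_ge0 n p (l : {ffun 'I_p -> A}) x : 0 <= moment n l x.
Proof. by apply: expect_ge0 => s; apply: prodr_ge0 => j _; apply: occupation_ge0. Qed.

(** Either no factor uses the site [x], or some factor [k] does, and then the others keep the whole
    trajectory, [x] included. *)
Lemma prod_occupation_cons p (l : {ffun 'I_p.+1 -> A}) x s :
  \prod_j occupation (l j) (x :: s) <= \prod_j occupation (l j) s +
    \sum_k phi (l k) x * \prod_j occupation (ffun_del k l j) (x :: s).
Proof.
have consE i : occupation i (x :: s) = phi i x + occupation i s.
  by rewrite /occupation big_cons.
rewrite (eq_bigr (fun j => phi (l j) x + occupation (l j) s)); last by move=> j _.
apply: le_trans (prodD_le (index_enum_uniq _) _ _) _ => [j|j|]; rewrite ?occupation_ge0 //.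
rewrite lerD2l le_eqVlt; apply/orP; left; apply/eqP; apply: eq_bigr => k _.
congr (_ * _); rewrite big_mkcond (bigD1_ord k) //= eqxx mul1r.
by apply: eq_bigr => j _; rewrite eq_sym neq_lift ffunE consE.
Qed.

(** The part where factor [k] is visited first, at time [a] and site [y]. By the Markov property the
    other factors restart from [y] with [n - a] steps left. *)
Definition first_visit n p (l : {ffun 'I_p.+1 -> A}) k x : R :=
  \sum_(a < n.+1) avgn a (fun y => phi (l k) y * moment (n - a) (ffun_del k l) y) x.

Lemma moment_le_first_visit n p (l : {ffun 'I_p.+1 -> A}) x :
  moment n l x <= \sum_k first_visit n l k x.
Proof.
elim: n x => [|n IHn] x.
  rewrite /moment /= (le_trans (prod_occupation_cons l x [::])) //.
  rewrite big_ord_recl {1}/occupation big_nil mul0r add0r.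
  by apply: ler_sum => k _; rewrite /first_visit big_ord1.
rewrite [leLHS]/moment /=.
apply: (@le_trans _ _ (avg (fun y => moment n l y +
    \sum_k phi (l k) x * expect n y (fun s =>
      \prod_j occupation (ffun_del k l j) (x :: y :: s))) x)).
  apply: le_avg => y; under [X in _ + X]eq_bigr do rewrite -expectZ.
  by rewrite -expect_sum -expectD; apply: le_expect => s; apply: prod_occupation_cons.
rewrite -[avg _ _]/(avgn 1 _ _) avgnDf avgn_sum /avgn /=.
apply: (@le_trans _ _ (avg (fun y => \sum_k first_visit n l k y) x +
    \sum_k phi (l k) x * moment n.+1 (ffun_del k l) x)).
  apply: lerD; first exact: le_avg.
  by apply: ler_sum => k _; rewrite avgZ.
rewrite avg_sum -big_split /=; apply: ler_sum => k _.
(* The summand at time 0 is the visit at [x]; the others are the averaged induction hypothesis with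
   time shifted by one. *)
rewrite {2}/first_visit big_ord_recl /= addrC subn0 lerD2l avg_sum.
by apply: ler_sum => a _; rewrite subSS.
Qed.

Section Step.
Variables (t B : R) (p : nat).
Hypothesis t01 : 0 < t < 1.
Hypothesis B_ge0 : 0 <= B.
Hypothesis moment2_le : forall n n' x y,
  \sum_(l : {ffun 'I_p -> A}) moment n l x * moment n' l y <= B / t ^+ (n + n').

Let C := B * (kappa / (1 - t)).

(** The diagonal case, in which both walks visit factor [k] first, at times [a] and [b]. The
    hypothesis [decay] controls this factor and [moment2_le] the remaining ones; [sum_pow_div_le]
    then sums over the times. *)
Lemma first_visit_sqr_le n k x :
  \sum_(l : {ffun 'I_p.+1 -> A}) first_visit n l k x ^+ 2 <= C * (t ^- n) ^+ 2.
Proof.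
case/andP: t01 => t0 t1.
pose h (i : A) (l : {ffun 'I_p -> A}) a (y : Z4) : R := phi i y * moment (n - a) l y.
rewrite (sum_ffun_del k (fun i l => (\sum_(a < n.+1) avgn a (h i l a) x) ^+ 2)).
under eq_bigr => c _ do rewrite expr2 big_distrlr.
rewrite exchange_big /=; under eq_bigr => a _ do rewrite exchange_big /=.
(* Here [C * (1 - t)] is [B * kappa], and the weight t^(a+b) comes from the [a + b] steps missing in
   the remaining moments. *)
apply: (@le_trans _ _ (\sum_(a < n.+1) \sum_(b < n.+1)
    C * (1 - t) * t ^- n ^+ 2 * (t ^+ (a + b) / (a + b).+1%:R))).
  apply: ler_sum => a _; apply: ler_sum => b _.
  have := @le_sum_avgnM R _ _ (fun c => h c.1 c.2 a) (fun c => h c.1 c.2 b) phi phi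
    (B / t ^+ (n - a + (n - b))) a b x x.
  move=> /(_ _)/le_trans; apply; last first.
    apply: le_trans (ler_wpM2l _ (decay a b x x)) _.
      exact: divr_ge0 B_ge0 (exprn_ge0 _ (ltW t0)).
    have aN := ltn_ord a; have bN := ltn_ord b.
    have -> : t ^+ (n - a + (n - b)) = t ^+ n ^+ 2 / t ^+ (a + b).
      rewrite -exprM (_ : n * 2 = n - a + (n - b) + (a + b))%N; last by lia.
      by rewrite [in RHS]exprD mulfK ?expf_neq0 ?gt_eqF.
    rewrite le_eqVlt; apply/orP; left; apply/eqP; rewrite /C; field.
    by rewrite -natrD nat1r pnatr_eq0 !expf_neq0 ?subr_eq0 ?gt_eqF.
  move=> x' y'.
  rewrite -(pair_bigA _ (fun i l => h i l a x' * h i l b y')) /=.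
  rewrite mulr_sumr; apply: ler_sum => i _.
  under eq_bigr do rewrite /h mulrACA.
  rewrite -mulr_sumr mulrC ler_wpM2r ?mulr_ge0 //.
under eq_bigr do rewrite -mulr_sumr.
rewrite -mulr_sumr; apply: le_trans (ler_wpM2l _ (sum_pow_div_le n.+1 t01)) _.
  by rewrite !mulr_ge0 ?invr_ge0 ?exprn_ge0 ?subr_ge0 // ltW.
by rewrite le_eqVlt; apply/orP; left; apply/eqP; field; rewrite expf_neq0 ?subr_eq0 gt_eqF.
Qed.

(** There are (p+1)^2 choices of the factors visited first by the two walks. Cauchy-Schwarz over [l]
    bounds each of them, equal or not, by the diagonal case. *)
Lemma moment2_step n n' x y :
  \sum_(l : {ffun 'I_p.+1 -> A}) moment n l x * moment n' l y <=
  p.+1%:R ^+ 2 * C / t ^+ (n + n').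
Proof.
case/andP: t01 => t0 t1.
apply: (@le_trans _ _ (\sum_(l : {ffun 'I_p.+1 -> A})
    (\sum_k first_visit n l k x) * (\sum_k first_visit n' l k y))).
  by apply: ler_sum => l _; apply: ler_pM; rewrite ?moment_ge0 ?moment_le_first_visit.
under eq_bigr do rewrite big_distrlr.
rewrite exchange_big /=; under eq_bigr => k _ do rewrite exchange_big /=.
apply: (@le_trans _ _ (\sum_(k < p.+1) \sum_(k' < p.+1) C * (t ^- n * t ^- n'))).
  apply: ler_sum => k _; apply: ler_sum => k' _.
  by apply: sum_mul_le; rewrite ?invr_gt0 ?exprn_gt0 //; apply: first_visit_sqr_le.
rewrite !sumr_const card_ord -mulrnA -[_ *+ (_ * _)]mulr_natr natrM exprD.
by rewrite le_eqVlt; apply/orP; left; apply/eqP; field; rewrite !expf_neq0 ?gt_eqF.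
Qed.

End Step.

Lemma moment2_le t p n n' x y : 0 < t < 1 ->
  \sum_(l : {ffun 'I_p -> A}) moment n l x * moment n' l y <=
  (p`!)%:R ^+ 2 * (kappa / (1 - t)) ^+ p / t ^+ (n + n').
Proof.
move=> t01; case/andP: (t01) => t0 t1.
elim: p n n' x y => [|p IHp] n n' x y.
  rewrite (big_pred1 [ffun i : 'I_0 => False_rect A (notF (ltn_ord i))]).
    rewrite /moment /= !(eq_expect _ _ (G := fun=> 1)) ?expect_cst => [|s|s]; rewrite ?big_ord0 //.
    by rewrite expr1n !mul1r invr_ge1 ?unitfE ?exprn_ile1 ?expf_neq0 ?exprn_gt0 ?gt_eqF ?ltW.
  by move=> l; apply/esym/eqP/ffunP => -[].
apply: le_trans (moment2_step t01 _ IHp _ _ _ _) _.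
  by rewrite mulr_ge0 ?exprn_ge0 ?divr_ge0 // subr_ge0 ltW.
by rewrite le_eqVlt; apply/orP; left; apply/eqP; rewrite factS natrM (exprS _ p); ring.
Qed.

End OccupationMoments.

(** * Truncated Green function *)

Section Kernel.
Variable R : realType.
Implicit Types (x y : Z4).

(** Telescoping of 1/(m+1) - 1/(m+2). *)
Lemma sum_inv_consecutive_le s N :
  \sum_(m < N) ((s + m).+1%:R * (s + m).+2%:R : R)^-1 <= s.+1%:R^-1.
Proof.
suff -> : \sum_(m < N) ((s + m).+1%:R * (s + m).+2%:R : R)^-1 =
    s.+1%:R^-1 - (s + N).+1%:R^-1 by rewrite gerBl invr_ge0.
elim: N => [|N IHN]; first by rewrite big_ord0 addn0 subrr.
rewrite big_ord_recr /= IHN addnS; field.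
by rewrite -!natrD !nat1r !pnatr_eq0.
Qed.

Definition green_trunc n x : R := \sum_(j < n.*2) hk R j x.

Lemma green_truncE n x :
  green_trunc n x = \sum_(m < n) (hk R m.*2 x + hk R m.*2.+1 x).
Proof.
rewrite /green_trunc; elim: n => [|n IHn]; first by rewrite !big_ord0.
by rewrite doubleS !big_ord_recr /= IHn addrA.
Qed.

Variable n : nat.

(** A time m < n and a midpoint. The radius [n + n] suffices for m-step paths that start in
    [reach n]. *)
Definition gram_index : finType := ('I_n * 'I_(size (reach (n + n))))%type.

(* Products of [p_m] alone only reach the even-time kernels [p_(2m)]; the summand
   [p_(m+1)] supplies the odd ones. *)
Definition gram (i : gram_index) x : R :=
  let z := nth 0 (reach (n + n)) i.2 in hk R i.1 (x - z) + hk R i.1.+1 (x - z).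

Lemma gram_ge0 i x : 0 <= gram i x.
Proof. by rewrite addr_ge0 ?hk_ge0. Qed.

Lemma sum_gram_index (F : nat -> Z4 -> R) :
  \sum_(i : gram_index) F i.1 (nth 0 (reach (n + n)) i.2) =
  \sum_(m < n) \sum_(z <- reach (n + n)) F m z.
Proof.
rewrite -(pair_bigA _ (fun (m : 'I_n) (i : 'I_(size (reach (n + n)))) =>
  F m (nth 0 (reach (n + n)) i))) /=.
by apply: eq_bigr => m _; rewrite (big_nth 0) big_mkord.
Qed.

Lemma avgn_gram a (i : gram_index) x :
  let z := nth 0 (reach (n + n)) i.2 in
  avgn a (gram i) x = hk R (a + i.1) (x - z) + hk R (a + i.1).+1 (x - z).
Proof. by rewrite /gram avgnDf !avgn_hk addnS. Qed.

(** The product opens into four midpoint sums, each at most a heat kernel at some time at least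
    a+b+m. This gives 64 = 4 * 16, and the sum over [m] telescopes. *)
Lemma gram_decay a b x y :
  \sum_i avgn a (gram i) x * avgn b (gram i) y <= 64 / (a + b).+1%:R.
Proof.
under eq_bigr do rewrite !avgn_gram /=.
rewrite (sum_gram_index (fun m z => (hk R (a + m) (x - z) + hk R (a + m).+1 (x - z)) *
  (hk R (b + m) (y - z) + hk R (b + m).+1 (y - z)))).
apply: (@le_trans _ _
  (\sum_(m < n) 64 * ((a + b + m).+1%:R * (a + b + m).+2%:R)^-1)); last first.
  by rewrite -mulr_sumr; apply: ler_wpM2l => //; apply: sum_inv_consecutive_le.
apply: ler_sum => m _.
have hk_le4 k : (a + b + m <= k)%N ->
    hk R k (x - y) <= 16 / ((a + b + m).+1%:R * (a + b + m).+2%:R).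
  move=> mk; apply: le_trans (hk_le R _ _) _; apply: ler_wpM2l => //.
  by rewrite lef_pV2 ?posrE ?mulr_gt0 // ler_pM ?ler_nat // !ltnS.
under eq_bigr do rewrite mulrDl !mulrDr.
rewrite !big_split /=.
rewrite [leRHS](_ : _ = 16 / ((a + b + m).+1%:R * (a + b + m).+2%:R) +
  16 / ((a + b + m).+1%:R * (a + b + m).+2%:R) +
  (16 / ((a + b + m).+1%:R * (a + b + m).+2%:R) +
  16 / ((a + b + m).+1%:R * (a + b + m).+2%:R))); last by ring.
apply: lerD; apply: lerD; apply: le_trans (@sum_hk_le _ _ _ _ _ _ (uniq_reach _)) (hk_le4 _ _); lia.
Qed.

(** The products p_m p_m and p_m p_(m+1) recover times 2m and 2m+1 exactly; the other two products
    are nonnegative and dropped. *)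
Lemma green_trunc_le_gram x y : x \in reach n ->
  green_trunc n (x - y) <= \sum_i gram i x * gram i y.
Proof.
move=> xn.
rewrite (sum_gram_index (fun m z => (hk R m (x - z) + hk R m.+1 (x - z)) *
  (hk R m (y - z) + hk R m.+1 (y - z)))).
rewrite green_truncE; apply: ler_sum => m _.
have xm : x \in reach (n + n - m) by apply: subset_reach xn; have := ltn_ord m; lia.
have nm : (n + n - m + m = n + n)%N by have := ltn_ord m; lia.
have := sum_hk_reach R m m y xm; have := sum_hk_reach R m m.+1 y xm.
rewrite nm addnS (addnn m) => <- <-; rewrite -big_split /=.
by apply: ler_sum => z _; rewrite mulrDl -mulrDr lerDl mulr_ge0 ?addr_ge0 ?hk_ge0.
Qed.

End Kernel.

(** * Law of the pair of walks *)

Fixpoint words (n : nat) : seq (seq Z4) :=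
  if n is n'.+1 then [seq e :: s | e <- steps, s <- words n'] else [:: [::]].

Lemma size_words n : size (words n) = (8 ^ n)%N.
Proof. by elim: n => //= n IHn; rewrite size_allpairs IHn size_steps expnS. Qed.

Lemma uniq_words n : uniq (words n).
Proof.
elim: n => //= n IHn; apply: allpairs_uniq => //; first exact: uniq_steps.
by move=> [e s] [e' s'] _ _ /= [-> ->].
Qed.

Lemma mem_words n s : s \in words n -> size s = n /\ {subset s <= steps}.
Proof.
elim: n s => [|n IHn] s /=; first by rewrite inE => /eqP ->.
move=> /allpairsP[[e s'] /= [es /IHn[<- ss] ->]]; split=> // z.
by rewrite inE => /predU1P[->//|/ss].
Qed.

Lemma reach_scanl r x s n : x \in reach r -> {subset s <= steps} ->
  (r + size s <= n)%N -> {subset scanl +%R x s <= reach n}.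
Proof.
elim: s r x => [//|e s IHs] r x xr ss; rewrite [size _]/= addnS => rn z /=.
have xer : x + e \in reach r.+1.
  by apply: reach_step => //; apply: ss; rewrite mem_head.
rewrite inE => /predU1P[->|].
  by apply: subset_reach xer; lia.
by apply: (IHs r.+1) => // w ws; apply: ss; rewrite inE ws orbT.
Qed.

(** Presents the iterated average as a uniform mean over words of steps, the form in which it meets
    the law of the walks. *)
Lemma expect_words (R : realType) n x (F : seq Z4 -> R) :
  expect n x F = 8%:R^-1 ^+ n * \sum_(s <- words n) F (scanl +%R x s).
Proof.
elim: n x F => [|n IHn] x F /=; first by rewrite big_seq1 mul1r.
rewrite big_allpairs_dep /avg exprS -mulrA; congr (_ * _); rewrite mulr_sumr.
by apply: eq_bigr => e _; rewrite IHn.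
Qed.

Definition trace (T : Type) (S : nat -> T -> Z4) n w : seq Z4 :=
  mkseq (fun i => S i.+1 w) n.

Definition increments (T : Type) (S : nat -> T -> Z4) n w : seq Z4 :=
  mkseq (fun i => increment S i w) n.

Lemma trace_increments (T : Type) (S : nat -> T -> Z4) n w :
  trace S n w = scanl +%R (S 0%N w) (increments S n w).
Proof.
have foldl_increments m : foldl +%R (S 0%N w) (increments S m w) = S m w.
  elim: m => [//|m IHm]; rewrite /increments mkseqS foldl_rcons IHm.
  by rewrite /increment addrC subrK.
elim: n => [//|n IHn]; rewrite /trace mkseqS -/(trace S n w) IHn.
by rewrite -(foldl_increments n.+1) /increments mkseqS scanl_rcons.
Qed.

Lemma pairmap_trace (T : Type) (S : nat -> T -> Z4) n w :
  pairmap (fun x y => y - x) (S 0%N w) (trace S n w) = increments S n w.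
Proof.
by rewrite trace_increments scanlK // => x y; rewrite addrC addKr.
Qed.

Lemma mkseq_preimage (T : Type) (X : nat -> T -> Z4) n s : size s = n ->
  (fun w => mkseq (X^~ w) n) @^-1` [set s] =
  \bigcap_(i in `I_n) (X i @^-1` [set nth 0 s i]).
Proof.
move=> sn; apply/seteqP; split => w /=.
  by move=> <- i; rewrite /= => lti; rewrite nth_mkseq.
move=> Xs; apply: (@eq_from_nth _ 0); rewrite size_mkseq // => i lti.
by rewrite nth_mkseq // Xs.
Qed.

Lemma measurable_trace d (T : measurableType d) (S : nat -> T -> Z4) n s :
  discrete_process S -> measurable (trace S n @^-1` [set s]).
Proof.
move=> mS; have [sn|/eqP sn] := eqVneq (size s) n.
  rewrite (mkseq_preimage (fun i => S i.+1) sn).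
  by apply: bigcap_measurableType => i _; apply: mS.
rewrite (_ : _ @^-1` _ = set0) //; apply/seteqP; split => w //= ws.
by apply: sn; rewrite -ws size_mkseq.
Qed.

(** This is [measurable_trace] on the space equipped with the sigma-algebra generated by [S], for
    which the process is trivially measurable. *)
Lemma process_sigma_algebra_trace (T : pointedType) (S : nat -> T -> Z4) n s :
  process_sigma_algebra S (trace S n @^-1` [set s]).
Proof.
pose G := [set A | exists m v, A = S m @^-1` [set v]].
apply: (@measurable_trace _ (g_sigma_algebraType G) S n s) => m v.
by apply: sub_gen_smallest; exists m, v.
Qed.

Lemma measurable_countable_preimage d (T : measurableType d) (U : countType)
    (V : T -> U) (B : set U) :
  (forall u, measurable (V @^-1` [set u])) -> measurable (V @^-1` B).
Proof.
move=> mV; rewrite (_ : _ @^-1` _ = \bigcup_u (if u \in B then V @^-1` [set u] else set0)).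
  apply: countable_bigcupT_measurable => [|u]; first exact: countableP.
  by case: ifP.
apply/seteqP; split => [w /= BV|w [u _]] /=.
  by exists (V w) => //; rewrite ifT //; apply: mem_set.
by case: ifPn => // /set_mem Bu ->.
Qed.

Section WalkLaw.
Variables (R : realType) (d : measure_display) (T : measurableType d).
Variables (P : probability T R).

Lemma prob_increments S n s : simple_random_walk P 0 S -> s \in words n ->
  P (increments S n @^-1` [set s]) = (8%:R^-1 ^+ n)%:E.
Proof.
case=> mS S0 iS uS /mem_words[sn ss].
rewrite (mkseq_preimage (increment S) sn).
have := iS (seq_fset tt (iota 0 n)) (fun m => [set nth 0 s m]).
rewrite (_ : [set` _] = `I_n); last first.
  by apply/seteqP; split => m /=; rewrite (seq_fsetE tt) mem_iota add0n.
move=> ->; rewrite big_seq.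
rewrite (eq_bigr (fun=> (8%:R^-1)%:E)); last first.
  move=> m; rewrite -[m \in _]/(m \in seq_fset tt _) seq_fsetE mem_iota add0n => /= mn.
  rewrite uS steps_unit //.
  by apply: ss; rewrite mem_nth // sn.
rewrite -big_seq big_const_seq count_predT size_seq_fset undup_id ?iota_uniq //.
by rewrite size_iota; elim: (n) => [//|k IHk]; rewrite iterS IHk -EFinM exprS.
Qed.

Variables (S S' : nat -> T -> Z4).
Hypothesis srwS : simple_random_walk P 0 S.
Hypothesis srwS' : simple_random_walk P 0 S'.
Hypothesis indep : independent_processes P S S'.

Lemma preimage_increments_trace X n s : simple_random_walk P 0 X ->
  increments X n @^-1` [set s] = trace X n @^-1` [set scanl +%R 0 s].
Proof.
case=> _ X0 _ _; apply/seteqP; split => w /= ws.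
  by rewrite trace_increments X0 ws.
by rewrite -pairmap_trace X0 ws scanlK // => x y; rewrite addrC addKr.
Qed.

Lemma measurable_increments X n s : simple_random_walk P 0 X ->
  measurable (increments X n @^-1` [set s]).
Proof.
move=> srwX; rewrite preimage_increments_trace //.
by apply: measurable_trace; case: srwX.
Qed.

Let V n w := (increments S n w, increments S' n w).

Let preimageV n s s' : V n @^-1` [set (s, s')] =
  (increments S n @^-1` [set s]) `&` (increments S' n @^-1` [set s']).
Proof. by apply/seteqP; split => w /= [<- <-]. Qed.

Let measurableV n u : measurable (V n @^-1` [set u]).
Proof.
by case: u => s s'; rewrite preimageV; apply: measurableI; apply: measurable_increments.
Qed.

Lemma prob_joint_increments n s s' : s \in words n -> s' \in words n ->
  P (V n @^-1` [set (s, s')]) = (8%:R^-1 ^+ n * 8%:R^-1 ^+ n)%:E.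
Proof.
move=> sn s'n; rewrite preimageV.
have -> := @indep (increments S n @^-1` [set s]) (increments S' n @^-1` [set s']) _ _.
- by rewrite !prob_increments.
- by rewrite preimage_increments_trace //; apply: process_sigma_algebra_trace.
- by rewrite preimage_increments_trace //; apply: process_sigma_algebra_trace.
Qed.

Let W n := [seq (s, s') | s <- words n, s' <- words n].

Let uW n : uniq (W n).
Proof.
by apply: allpairs_uniq; rewrite ?uniq_words // => -[? ?] [? ?] _ _ /= [-> ->].
Qed.

(** The 64^n pairs of words have probability 64^(-n) each, so they already exhaust the total
    mass. *)
Lemma ae_words n : {ae P, forall w, V n w \in W n}.
Proof.
have mW : measurable (V n @^-1` [set` W n]) by apply: measurable_countable_preimage.
exists (~` (V n @^-1` [set` W n])); split.
- exact: measurableC.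
- rewrite probability_setC //.
  suff -> : P (V n @^-1` [set` W n]) = 1%E by rewrite subee.
  rewrite (_ : _ @^-1` _ = \bigcup_(u in [set` W n]) (V n @^-1` [set u])); last first.
    by apply/seteqP; split => [w Ww|w [u Wu /= ->] //]; exists (V n w).
  rewrite measure_fin_bigcup //; first last.
    by apply/trivIsetP => u v _ _ uv; apply/seteqP; split => // w /= [-> /eqP]; rewrite (negbTE uv).
    exact: finite_seq.
  rewrite -(fsbig_seq _ _ (uW n)) big_allpairs /=.
  under eq_big_seq => s sn.
    under eq_big_seq => s' s'n do rewrite prob_joint_increments //.
    rewrite sumEFin; over.
  rewrite sumEFin !big_const_seq !count_predT size_words !iter_addr_0.
  rewrite -mulrnA -[_ *+ (_ * _)]mulr_natr natrM natrX -exprMn.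
  by rewrite -exprMn -exprMn [X in X ^+ n](_ : _ = 1) ?expr1n //; field.
- exact: subset_refl.
Qed.

(** Almost surely the integrand is at most a finite combination of indicators of the events
    [V n = u], whose integral is the double mean of [G]. The comparison of [F] with [G] is only
    asked on lists that traces can produce. *)
Lemma integral_le_expect n (F : seq Z4 -> seq Z4 -> \bar R) (G : seq Z4 -> seq Z4 -> R) :
    (forall s s', 0 <= F s s')%E -> (forall s s', 0 <= G s s') ->
    (forall s s', {subset s <= reach n} -> {subset s' <= reach n} -> size s = n -> size s' = n ->
      (F s s' <= (G s s')%:E)%E) ->
  (\int[P]_w F (trace S n w) (trace S' n w) <=
   (expect n 0 (fun s => expect n 0 (G s)))%:E)%E.
Proof.
move=> F0 G0 FG.
pose f (u : seq Z4 * seq Z4) := F (scanl +%R 0 u.1) (scanl +%R 0 u.2).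
pose g (u : seq Z4 * seq Z4) := G (scanl +%R 0 u.1) (scanl +%R 0 u.2).
have fE : (fun w => F (trace S n w) (trace S' n w)) = f \o V n.
  apply/funext => w; rewrite !trace_increments.
  by case: srwS => _ -> _ _; case: srwS' => _ -> _ _.
have m1 u : measurable_fun setT (fun w => (\1_(V n @^-1` [set u]) w : R)%:E).
  by apply/measurable_EFinP; apply: measurable_indic.
apply: (@le_trans _ _ (\int[P]_w \sum_(u <- W n) (g u)%:E * (\1_(V n @^-1` [set u]) w)%:E)%E).
  apply: ae_ge0_le_integral => //.
  (* The integrand factors through the countably valued [V n], which makes it measurable. *)
  - rewrite fE => _ Y mY; rewrite setTI.
    exact: (@measurable_countable_preimage _ _ _ (V n) (f @^-1` Y)).
  - by move=> w _; apply: sume_ge0 => u _; rewrite mule_ge0 ?lee_fin ?G0.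
  - by apply: emeasurable_sum => u; apply: measurable_funeM.
  apply: filterS (ae_words n) => w Ww _.
  rewrite -[F _ _]/((fun w => F (trace S n w) (trace S' n w)) w) fE /=.
  rewrite (bigD1_seq (V n w)) //= indicE mem_set // mule1.
  apply: (@le_trans _ _ (g (V n w))%:E); last first.
    by rewrite leeDl // sume_ge0 // => u _; rewrite mule_ge0 ?lee_fin ?G0.
  move: (V n w) Ww => _ /allpairsP[[s s'] /= [/mem_words[ns ss] /mem_words[ns' ss'] ->]].
  apply: FG; rewrite ?size_scanl //.
    by apply: (@reach_scanl 0) => //; rewrite ?mem_seq1 // ns.
  by apply: (@reach_scanl 0) => //; rewrite ?mem_seq1 // ns'.
rewrite ge0_integral_sum //; last first.
- by move=> u w _; rewrite mule_ge0 ?lee_fin ?G0.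
- by move=> u; apply: measurable_funeM.
rewrite big_allpairs /=.
under eq_big_seq => s sn.
  under eq_big_seq => s' s'n.
    rewrite ge0_integralZl_EFin ?G0 //.
    rewrite integral_indic // setIT [X in (_ * X)%E](prob_joint_increments sn s'n) -EFinM.
    over.
  rewrite sumEFin; over.
rewrite sumEFin lee_fin expect_words mulr_sumr.
under [leRHS]eq_bigr do rewrite expect_words mulrA mulr_sumr.
by under eq_bigr do under eq_bigr do rewrite mulrC.
Qed.

End WalkLaw.

(** * Proof of the moment bound *)

Section Numeric.
Variable R : realType.

(** The induction step is (1 + 1/p)^p <= e. *)
Lemma expn_self_le p : p%:R ^+ p <= expR 1 ^+ p * (p`!)%:R :> R.
Proof.
elim: p => [|p IHp]; first by rewrite !expr0 mul1r.
have step : p.+1%:R ^+ p <= expR 1 * p%:R ^+ p :> R.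
  case: p IHp => [|p] _; first by rewrite !expr0 mulr1 -{1}expR0 ler_expR.
  have -> : p.+2%:R = (1 + p.+1%:R^-1) * p.+1%:R :> R.
    by rewrite mulrDl mul1r mulVf ?pnatr_eq0 // -natr1.
  rewrite exprMn ler_wpM2r ?exprn_ge0 //.
  apply: (@le_trans _ _ (expR p.+1%:R^-1 ^+ p.+1)).
    by rewrite lerXn2r ?nnegrE ?addr_ge0 ?expR_ge0 ?invr_ge0 // expR_ge1Dx.
  by rewrite -expRM_natl mulfV ?pnatr_eq0.
apply: (@le_trans _ _ (p.+1%:R * (expR 1 * (expR 1 ^+ p * (p`!)%:R)))).
  rewrite exprS; apply: ler_wpM2l => //; apply: le_trans step _.
  by apply: ler_wpM2l; rewrite ?expR_ge0.
by rewrite factS natrM (exprS (expR 1)) le_eqVlt; apply/orP; left; apply/eqP; ring.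
Qed.

Lemma fact_le_expn p : (p`! <= p ^ p)%N.
Proof.
elim: p => [//|p IHp]; rewrite factS expnS leq_mul2l /=.
by apply: leq_trans IHp _; case: p => // p; rewrite leq_exp2r.
Qed.

(** Here 1/(1-t) = (n+p)/p <= 2n/p, and t^(-2n) = (1+p/n)^(2n) <= e^(2p). The powers of n cancel,
    and p! <= p^p removes one of the two factorials. *)
Lemma moment_constant_le p n (t : R) : (0 < p <= n)%N -> t = n%:R / (n + p)%N%:R ->
  n%:R^-1 ^+ p * ((p`!)%:R ^+ 2 * (64 / (1 - t)) ^+ p / t ^+ (n + n)) <=
  (p`!)%:R * (128 * expR 2) ^+ p.
Proof.
move=> /andP[p0 pn] ->; have n0 : (0 < n)%N by apply: leq_trans pn.
have [pR nR] : 0 < p%:R :> R /\ 0 < n%:R :> R by rewrite !ltr0n.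
have npR : 0 < n%:R + p%:R :> R by rewrite addr_gt0.
have -> : 64 / (1 - n%:R / (n + p)%N%:R) = 64 * ((n%:R + p%:R) / p%:R) :> R.
  by rewrite natrD; field; rewrite ?gt_eqF //= addrC addKr gt_eqF.
have le_sum : (n%:R + p%:R) / p%:R <= 2 * n%:R / p%:R :> R.
  by rewrite ler_wpM2r ?invr_ge0 // mulr_natl mulr2n lerD2l ler_nat.
have le_exp : ((n%:R / (n + p)%N%:R) ^+ (n + n))^-1 <= expR 2 ^+ p :> R.
  rewrite -exprVn invf_div natrD mulrDl divff ?gt_eqF //.
  apply: (@le_trans _ _ (expR (p%:R / n%:R) ^+ (n + n))).
    by rewrite lerXn2r ?nnegrE ?addr_ge0 ?divr_ge0 ?expR_ge0 // expR_ge1Dx.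
  rewrite -!expRM_natl natrD ler_expR le_eqVlt; apply/orP; left; apply/eqP.
  by field; rewrite gt_eqF.
have le_fact : (p`!)%:R / p%:R ^+ p <= 1 :> R.
  by rewrite ler_pdivrMr ?exprn_gt0 // mul1r -natrX ler_nat fact_le_expn.
apply: (@le_trans _ _ (n%:R^-1 ^+ p *
    ((p`!)%:R ^+ 2 * (64 * (2 * n%:R / p%:R)) ^+ p * expR 2 ^+ p))).
  apply: ler_wpM2l; first by rewrite exprn_ge0 ?invr_ge0.
  have c0 : 0 <= 64 * ((n%:R + p%:R) / p%:R) :> R by rewrite mulr_ge0 ?divr_ge0 ?ltW.
  apply: ler_pM => //; apply: ler_wpM2l; first by rewrite exprn_ge0.
  have c : 64 * ((n%:R + p%:R) / p%:R) <= 64 * (2 * n%:R / p%:R) :> R.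
    exact: ler_wpM2l.
  by rewrite lerXn2r // nnegrE (le_trans c0).
rewrite [leLHS](_ : _ = (p`!)%:R / p%:R ^+ p * ((p`!)%:R * (128 * expR 2) ^+ p)).
  by rewrite ler_piMl // mulr_ge0 // exprn_ge0 // mulr_ge0 // expR_ge0.
rewrite (_ : 64 * _ = 128 * (n%:R / p%:R)); last by field; rewrite gt_eqF.
by rewrite !exprMn !exprVn; field; rewrite ?expf_neq0 ?gt_eqF.
Qed.

Lemma exprD_le (a b : R) p : 0 <= a -> 0 <= b ->
  (a + b) ^+ p <= 2 ^+ p * (a ^+ p + b ^+ p).
Proof.
move=> a0 b0; wlog ab : a b a0 b0 / a <= b.
  by move=> H; have [/H|/ltW/H] := leP a b; [apply | rewrite addrC [_ ^+ p + _]addrC; apply].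
apply: (@le_trans _ _ ((2 * b) ^+ p)).
  by rewrite lerXn2r ?nnegrE ?addr_ge0 ?mulr_ge0 //; lra.
by rewrite exprMn ler_wpM2l ?exprn_ge0 // lerDr exprn_ge0.
Qed.

Lemma expect_last n x (f : Z4 -> R) : expect n x (fun s => f (last x s)) = avgn n f x.
Proof.
elim: n x f => [//|n IHn] x f /=.
by apply: eq_avg => y /=; rewrite -IHn.
Qed.

(** By [hk_le] the times from 2n on form a telescoping tail, bounded uniformly in [N]. *)
Lemma sum_hk_le_trunc n N z :
  \sum_(i < N) hk R i z <= green_trunc R n z + 16 / n.*2.+1%:R.
Proof.
apply: (@le_trans _ _ (\sum_(i < n.*2 + N) hk R i z)).
  rewrite -!(big_mkord xpredT (fun i => hk R i z)) [leRHS](big_cat_nat (n := N)) ?leq_addl //=.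
  by rewrite lerDl sumr_ge0 // => i _; apply: hk_ge0.
rewrite big_split_ord /= lerD2l.
apply: (@le_trans _ _ (\sum_(m < N) 16 * ((n.*2 + m).+1%:R * (n.*2 + m).+2%:R)^-1)).
  by apply: ler_sum => m _; apply: hk_le.
by rewrite -mulr_sumr; apply: ler_wpM2l => //; apply: sum_inv_consecutive_le.
Qed.

Section GramMoments.
Variables (p n : nat).

Let K x y : R := \sum_(i : gram_index n) gram R i x * gram R i y.

Lemma expect_gram_le (t : R) : 0 < t < 1 ->
  expect n 0 (fun s => expect n 0 (fun s' =>
    (\sum_(x <- s) \sum_(y <- s') K x y) ^+ p)) <=
  (p`!)%:R ^+ 2 * (64 / (1 - t)) ^+ p / t ^+ (n + n).
Proof.
move=> t01.
apply: le_trans (moment2_le (ler0n _ _) (@gram_ge0 R n) (@gram_decay R n) p n n 0 0 t01).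
pose occ := @occupation R _ (@gram R n).
(* The kernel is a sum of products, so the p-th power expands over [l] into a function of one walk
   times the same function of the other. *)
have KE s s' : (\sum_(x <- s) \sum_(y <- s') K x y) ^+ p =
    \sum_(l : {ffun 'I_p -> gram_index n})
      (\prod_j occ (l j) s) * (\prod_j occ (l j) s').
  rewrite (_ : \sum_(x <- s) _ = \sum_i occ i s * occ i s').
    rewrite -[in LHS](card_ord p) -prodr_const bigA_distr_bigA /=.
    by apply: eq_bigr => l _; rewrite big_split.
  under [RHS]eq_bigr do rewrite /occ /occupation big_distrlr.
  rewrite [RHS]exchange_big /=; apply: eq_bigr => x _.
  by rewrite [RHS]exchange_big.
rewrite (eq_expect _ _ (G := fun s => \sum_(l : {ffun 'I_p -> gram_index n})
    expect n 0 (fun s' => \prod_j occ (l j) s') * (\prod_j occ (l j) s))); last first.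
  move=> s; rewrite (eq_expect _ _ (KE s)) expect_sum.
  by apply: eq_bigr => l _; rewrite expectZ mulrC.
rewrite expect_sum; apply: ler_sum => l _; rewrite expectZ.
(* Counting the starting point, as [moment] does, only enlarges the product. *)
have occ_le : expect n 0 (fun s => \prod_j occ (l j) s) <= moment (@gram R n) n l 0.
  apply: le_expect => s; apply: ler_prod => j _.
  rewrite occupation_ge0 /=; last exact: gram_ge0.
  by rewrite /occ /occupation big_cons lerDr gram_ge0.
have e0 : 0 <= expect n 0 (fun s => \prod_j occ (l j) s).
  apply: expect_ge0 => s; apply: prodr_ge0 => j _; apply: occupation_ge0; exact: gram_ge0.
exact: ler_pM.
Qed.

End GramMoments.
End Numeric.

(** * Transfer to the two walks and the two regimes of p and n *)

Section Main.
Variables (R : realType) (d : measure_display) (T : measurableType d).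
Variables (P : probability T R) (S S' : nat -> T -> Z4).
Hypothesis srwS : simple_random_walk P 0 S.
Hypothesis srwS' : simple_random_walk P 0 S'.
Hypothesis indep : independent_processes P S S'.

Lemma prob_walk_le i x y : (P [set w | (x + S i w)%R = y] <= (hk R i (x - y))%:E)%E.
Proof.
pose A := S i @^-1` [set y - x].
have lastE w : last 0 (trace S i w) = S i w.
  by case: i {A} => [|i]; [case: srwS | rewrite /trace mkseqS last_rcons].
have -> : [set w | (x + S i w)%R = y] = A.
  apply/seteqP; split => w; rewrite /A /=; first by move=> <-; rewrite addrAC subrr add0r.
  by move=> ->; rewrite addrC subrK.
have mA : measurable A by case: srwS => + _ _ _; apply.
rewrite -[A]setIT -integral_indic //.
pose f (s : seq Z4) : R := (last 0 s == y - x)%:R.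
rewrite (eq_integral (fun w => (f (trace S i w))%:E)); last first.
  move=> w _; rewrite /f lastE indicE; congr (_%:R%:E); congr nat_of_bool.
  by apply/idP/eqP => [/set_mem|Sw] //; apply/mem_set.
(* A statement on one walk, read off from the estimate for the pair with functions that ignore the
   second trace. *)
apply: le_trans (integral_le_expect srwS srwS' indep (n := i)
  (F := fun s _ => (f s)%:E) (G := fun s _ => f s) _ _ _) _ => //.
- by move=> s s'; rewrite lee_fin.
rewrite lee_fin (eq_expect _ _ (G := f)); last by move=> s; rewrite expect_cst.
rewrite /f (expect_last i 0 (fun z => (z == y - x)%:R)) -hkE.
by rewrite sub0r opprB.
Qed.

Lemma green_le n x y :
  (green P S x y <= (green_trunc R n (x - y) + 16 / n.*2.+1%:R)%:E)%E.
Proof.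
rewrite /green; apply: lime_le; first by apply: is_cvg_nneseries.
apply: nearW => N; rewrite big_mkord.
apply: (@le_trans _ _ (\sum_(i < N) hk R i (x - y))%:E).
  by rewrite -sumEFin; apply: lee_sum => i _; apply: prob_walk_le.
by rewrite lee_fin sum_hk_le_trunc.
Qed.

Lemma green_ge0 x y : (0 <= green P S x y)%E.
Proof. by apply: nneseries_ge0. Qed.

Let X n (s s' : seq Z4) : \bar R :=
  ((n%:R^-1 : R)%:E * \sum_(x <- s) \sum_(y <- s') green P S x y)%E.

Lemma green_average_trace n w :
  green_average P S S' n w = X n (trace S n w) (trace S' n w).
Proof.
congr (_ * _)%E; rewrite big_add1 /= big_map /index_iota subn0.
by apply: eq_bigr => i _; rewrite big_add1 /= big_map /index_iota subn0.
Qed.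

Let X_ge0 n s s' : (0 <= X n s s')%E.
Proof.
rewrite mule_ge0 ?lee_fin ?invr_ge0 //; apply: sume_ge0 => x _.
by apply: sume_ge0 => y _; apply: green_ge0.
Qed.

Lemma expe_le_fin (x : \bar R) (r : R) p :
  (0 <= x)%E -> (x <= r%:E)%E -> (x ^+ p <= (r ^+ p)%:E)%E.
Proof.
case: x => [x| |] //; rewrite !lee_fin => x0 xr.
by rewrite -EFin_expe lee_fin lerXn2r ?nnegrE // (le_trans x0).
Qed.

Lemma X_le n (k : Z4 -> Z4 -> R) s s' : (0 < n)%N -> size s = n -> size s' = n ->
    (forall x y, x \in s -> y \in s' -> (green P S x y <= (k x y)%:E)%E) ->
  (X n s s' <= (n%:R^-1 * \sum_(x <- s) \sum_(y <- s') k x y)%:E)%E.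
Proof.
move=> n0 ns ns' gk; rewrite /X EFinM; apply: lee_wpmul2l.
  by rewrite lee_fin invr_ge0.
rewrite -sumEFin big_seq [leRHS]big_seq; apply: lee_sum => x xs.
by rewrite -sumEFin big_seq [leRHS]big_seq; apply: lee_sum => y ys; apply: gk.
Qed.

Lemma sum_sum_cst (s s' : seq Z4) n (c : R) : (0 < n)%N -> size s = n -> size s' = n ->
  n%:R^-1 * \sum_(x <- s) \sum_(y <- s') c = n%:R * c.
Proof.
move=> n0 ns ns'; rewrite !big_const_seq !count_predT ns ns' !iter_addr_0.
by rewrite -[c *+ n]mulr_natl -[n%:R * c *+ n]mulr_natl mulKf // pnatr_eq0 -lt0n.
Qed.

Lemma moment_small n p : (0 < n <= p)%N ->
  (\int[P]_w (green_average P S S' n w ^+ p) <= ((16 * expR 1) ^+ p * (p`!)%:R)%:E)%E.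
Proof.
case/andP=> n0 np.
under eq_integral do rewrite green_average_trace.
apply: le_trans (integral_le_expect srwS srwS' indep (n := n)
  (F := fun s s' => (X n s s' ^+ p)%E) (G := fun _ _ => (n%:R * 16) ^+ p) _ _ _) _.
- by move=> s s'; apply: expe_ge0.
- by move=> s s'; rewrite exprn_ge0 ?mulr_ge0.
- move=> s s' _ _ ns ns'; apply: expe_le_fin => //.
  rewrite -(sum_sum_cst 16 n0 ns ns'); apply: X_le => // x y _ _.
  (* Truncating at time 0 makes the whole series a tail, so the Green function is at most 16. *)
  by have := green_le 0 x y; rewrite /green_trunc big_ord0 add0r divr1.
rewrite lee_fin (eq_expect _ _ (G := fun=> (n%:R * 16) ^+ p)); last first.
  by move=> s; rewrite expect_cst.
rewrite expect_cst mulrC !exprMn -mulrA ler_wpM2l ?exprn_ge0 //.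
apply: le_trans (expn_self_le R p).
by rewrite lerXn2r ?nnegrE ?ler_nat.
Qed.

(** The average splits into a Gram part and a tail part of size at most 8; [exprD_le] separates
    their p-th powers. *)
Lemma moment_large n p : (0 < p <= n)%N ->
  (\int[P]_w (green_average P S S' n w ^+ p) <=
   ((4 * (128 * expR 2 + 8)) ^+ p * (p`!)%:R)%:E)%E.
Proof.
move=> pn; case/andP: (pn) => p0 pn'; have n0 : (0 < n)%N by apply: leq_trans pn'.
pose K x y : R := \sum_(i : gram_index n) gram R i x * gram R i y.
have K0 x y : 0 <= K x y by apply: sumr_ge0 => i _; rewrite mulr_ge0 ?gram_ge0.
pose Y (s s' : seq Z4) : R := \sum_(x <- s) \sum_(y <- s') K x y.
have Y0 s s' : 0 <= Y s s' by do 2![apply: sumr_ge0 => ? _].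
under eq_integral do rewrite green_average_trace.
pose G s s' : R := 2 ^+ p * (n%:R^-1 ^+ p * Y s s' ^+ p + 8 ^+ p).
apply: le_trans (integral_le_expect srwS srwS' indep (n := n)
  (F := fun s s' => (X n s s' ^+ p)%E) (G := G) _ _ _) _.
- by move=> s s'; apply: expe_ge0.
- by move=> s s'; rewrite mulr_ge0 ?addr_ge0 ?mulr_ge0 ?exprn_ge0 ?invr_ge0.
- move=> s s' sn _ ns ns'.
  apply: (@le_trans _ _ ((n%:R^-1 * Y s s' + 8) ^+ p)%:E); last first.
    by rewrite lee_fin /G -exprMn exprD_le // mulr_ge0 ?invr_ge0.
  apply: expe_le_fin => //.
  have := @X_le n (fun x y => K x y + 16 / n.*2.+1%:R) s s' n0 ns ns' => H.
  apply: le_trans (H _) _ => [x y xs _|].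
    apply: le_trans (green_le n x y) _.
    by rewrite lee_fin lerD2r green_trunc_le_gram // sn.
  rewrite lee_fin; under eq_bigr do rewrite big_split.
  rewrite big_split mulrDr lerD2l /= sum_sum_cst //.
  (* The tail part is 16n/(2n+1). *)
  rewrite mulrA ler_pdivrMr ?ltr0n // -!natrM ler_nat.
  by lia.
rewrite lee_fin.
rewrite (eq_expect _ _ (G := fun s => 2 ^+ p * n%:R^-1 ^+ p *
  expect n 0 (fun s' => Y s s' ^+ p) + 2 ^+ p * 8 ^+ p)); last first.
  move=> s; rewrite -expectZ -[X in _ = _ + X](expect_cst n 0) -expectD.
  by apply: eq_expect => s'; rewrite /G mulrDr mulrA.
rewrite expectD expect_cst expectZ.
pose t : R := n%:R / (n + p)%N%:R.
have np : (0 < n + p)%N by rewrite addn_gt0 n0.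
have t01 : 0 < t < 1.
  by rewrite divr_gt0 ?ltr0n //= ltr_pdivrMr ?ltr0n // mul1r ltr_nat -addn1 leq_add2l.
have le1 : n%:R^-1 ^+ p * expect n 0 (fun s => expect n 0 (fun s' => Y s s' ^+ p)) <=
    (p`!)%:R * (128 * expR 2) ^+ p.
  apply: le_trans (moment_constant_le pn (erefl t)).
  by apply: ler_wpM2l; [rewrite exprn_ge0 ?invr_ge0 | apply: expect_gram_le].
have D0 : 0 <= 128 * expR 2 :> R by rewrite mulr_ge0 ?expR_ge0.
set D := 128 * expR 2 in le1 D0 *.
rewrite -mulrA -mulrDr.
apply: (@le_trans _ _ (2 ^+ p * ((p`!)%:R * (D + 8) ^+ p + (p`!)%:R * (D + 8) ^+ p))).
  apply: ler_wpM2l; rewrite ?exprn_ge0 //; apply: lerD.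
    apply: le_trans le1 _; apply: ler_wpM2l => //.
    by rewrite lerXn2r ?nnegrE ?addr_ge0 // lerDl.
  apply: (@le_trans _ _ (1 * (D + 8) ^+ p)).
    by rewrite mul1r lerXn2r ?nnegrE ?addr_ge0 // lerDr.
  by apply: ler_wpM2r; rewrite ?exprn_ge0 ?addr_ge0 // (ler_nat _ 1) fact_gt0.
(* One factor 2^p comes from [exprD_le]; the other absorbs the two equal summands, as p is
   positive. *)
rewrite [leRHS](_ : _ = 2 ^+ p * (2 ^+ p * ((p`!)%:R * (D + 8) ^+ p))); last first.
  by rewrite (_ : 4 = 2 * 2) ?exprMn; ring.
apply: ler_wpM2l; rewrite ?exprn_ge0 // -mulr2n -[_ * _ *+ 2]mulr_natl.
apply: ler_wpM2r; first by rewrite mulr_ge0 ?exprn_ge0 ?addr_ge0.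
by rewrite -[leLHS]expr1 ler_weXn2l // ler1n.
Qed.

End Main.

Theorem lemma4p1 (R : realType) (d : measure_display) (T : measurableType d)
    (P : probability T R) (S S' : nat -> T -> Z4)
    (srwS : simple_random_walk P 0 S)
    (srwS' : simple_random_walk P 0 S')
    (indep : independent_processes P S S') :
  exists C : R, forall p n : nat, (1 <= p)%N -> (1 <= n)%N ->
    (\int[P]_w (green_average P S S' n w ^+ p) <= (C ^+ p * (p`!)%:R)%:E)%E.
Proof.
(* The constant of [moment_large], which exceeds the constant 16e of [moment_small]. *)
exists (4 * (128 * expR 2 + 8)) => p n p0 n0.
have [pn|/ltnW np] := leqP p n; first by apply: moment_large; rewrite ?p0.
apply: le_trans (moment_small srwS srwS' indep _) _; first by rewrite n0.
rewrite lee_fin; apply: ler_wpM2r => //.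
have e12 : expR 1 <= expR 2 :> R by rewrite ler_expR ler1n.
have e0 := expR_ge0 (1 : R).
by rewrite lerXn2r ?nnegrE ?mulr_ge0 ?addr_ge0 //; lra.
Qed.
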